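(* The Jacobi structure on $M=\mathbb{R}^3$ (coordinates $x,y,z$) given by $$\pi=(x^4+y^4)\frac{\partial}{\partial x}\wedge\frac{\partial}{\partial y}+x\frac{\partial}{\partial z}\wedge\frac{\partial}{\partial x}-y\frac{\partial}{\partial y}\wedge\frac{\partial}{\partial z},\qquad E=2\frac{\partial}{\partial z}$$ admits a contact resolution.
   Context: A Jacobi structure on a manifold $M$ is a pair $(\pi,E)$ of a bivector field and a vector field with $[\pi,\pi]=2E\wedge\pi$ and $[E,\pi]=0$, where the Schouten bracket of bivector fields is normalized by $[X_1\wedge X_2,Y_1\wedge Y_2]=\sum_{i,j\in\{1,2\}}(-1)^{i+j}[X_i,Y_j]\wedge X_{3-i}\wedge Y_{3-j}$ and $[E,\pi]=L_E\pi$. A contact manifold of dimension $2n+1$ is regarded as a manifold $\Sigma$ with a Jacobi structure $(\Pi_\Sigma,E_\Sigma)$ such that $E_\Sigma\wedge\Pi_\Sigma^n$ vanishes at no point. A smooth map $\varphi:\Sigma\to M$ between Jacobi manifolds is a Jacobi morphism if $\Pi_\Sigma$ and $E_\Sigma$ are projected by $\varphi$ onto $\pi$ and $E$, i.e. $E_\Sigma[\varphi^*f]=\varphi^*(E[f])$ and $\Pi_\Sigma(d\varphi^*f,d\varphi^*g)=\varphi^*(\pi(df,dg))$ for all $f,g\in C^\infty(M)$. A contact resolution of a Jacobi manifold $M$ of dimension $d$ is a contact manifold $\Sigma$ of the same dimension $d$ together with a surjective Jacobi morphism $\varphi:\Sigma\to M$. *)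

(* Defs.v *)
From HB Require Import structures.
From mathcomp Require Import all_boot all_order all_algebra.
From mathcomp Require Import all_classical all_reals all_analysis.
Import Order.TTheory GRing.Theory Num.Theory.
Import numFieldNormedType.Exports.

Set Implicit Arguments.
Unset Strict Implicit.
Unset Printing Implicit Defensive.

Local Open Scope classical_set_scope.
Local Open Scope ring_scope.

Section Smooth.
Context {R : realType} {d : nat}.

Definition dvec (i : 'I_d) : 'rV[R]_d := delta_mx 0 i.

(* [Ck k U f]: all iterated partial derivatives of [f] of order at most [k]
   exist and are continuous at the points of [U].  Only used with [U] open. *)
Fixpoint Ck (W : normedModType R) (k : nat) (U : set 'rV[R]_d)
    (f : 'rV[R]_d -> W) : Prop :=
  match k with
  | 0 => forall x, U x -> {for x, continuous f}
  | k'.+1 => (forall x, U x -> differentiable f x) /\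
             forall i : 'I_d, Ck k' U (fun x => 'D_(dvec i) f x)
  end.

Definition smooth_on (W : normedModType R) (U : set 'rV[R]_d)
    (f : 'rV[R]_d -> W) : Prop := forall k, Ck k U f.

End Smooth.

Record chart (R : realType) (d : nat) (T : topologicalType) := Chart {
  source : set T;
  target : set 'rV[R]_d;
  coord : T -> 'rV[R]_d;
  param : 'rV[R]_d -> T;
  open_source : open source;
  open_target : open target;
  coord_target : forall p, source p -> target (coord p);
  param_source : forall x, target x -> source (param x);
  coordK : forall p, source p -> param (coord p) = p;
  paramK : forall x, target x -> coord (param x) = x;
  coord_cont : forall p, source p -> {for p, continuous coord};
  param_cont : forall x, target x -> {for x, continuous param} }.

Section Transition.
Context {R : realType} {d : nat} {T : topologicalType}.

Definition overlap (c c' : chart R d T) : set 'rV[R]_d :=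
  [set x | target c x /\ source c' (param c x)].

Definition transition (c c' : chart R d T) : 'rV[R]_d -> 'rV[R]_d :=
  coord c' \o param c.

End Transition.

(* [chart_at] selects some chart around each point; it is only used to evaluate
   quantities that do not depend on the chart. *)
Record manifold (R : realType) (d : nat) := Manifold {
  carrier :> topologicalType;
  manifold_hausdorff : hausdorff_space carrier;
  manifold_second_countable : @second_countable carrier;
  chart_idx : Type;
  atlas : chart_idx -> chart R d carrier;
  chart_at : carrier -> chart_idx;
  chart_atP : forall p, source (atlas (chart_at p)) p;
  transition_smooth : forall i j,
    smooth_on (overlap (atlas i) (atlas j)) (transition (atlas i) (atlas j)) }.
Arguments atlas {R d} m.
Arguments chart_at {R d m}.

Section Maps.
Context {R : realType}.

Definition smooth_function (d : nat) (M : manifold R d) (f : M -> R) : Prop :=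
  forall i, smooth_on (target (atlas M i)) (f \o param (atlas M i)).

Definition smooth_map (d d' : nat) (M : manifold R d) (N : manifold R d')
    (phi : M -> N) : Prop :=
  continuous phi /\
  forall i j,
    smooth_on
      [set x | target (atlas M i) x /\
               source (atlas N j) (phi (param (atlas M i) x))]
      (coord (atlas N j) \o phi \o param (atlas M i)).

End Maps.

(* A tensor field is the family, over the charts [i] of the atlas, of its
   components, given as functions of the coordinates (meaningful on the target
   of the chart [i]) and related by the tensor transformation law.  The bivector
   [sum_(a < b) P a b d_a /\ d_b] is encoded by the antisymmetric matrix [P].
   In the library's row-vector convention, ['J f x] acts on the right. *)

Section Fields.
Context {R : realType} {d : nat} (M : manifold R d).

Definition vcomponents := chart_idx M -> 'rV[R]_d -> 'rV[R]_d.
Definition bcomponents := chart_idx M -> 'rV[R]_d -> 'M[R]_d.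

Definition vector_field (X : vcomponents) : Prop :=
  (forall i, smooth_on (target (atlas M i)) (X i)) /\
  forall i j x, overlap (atlas M i) (atlas M j) x ->
    X j (transition (atlas M i) (atlas M j) x) =
    X i x *m 'J (transition (atlas M i) (atlas M j)) x.

Definition bivector_field (P : bcomponents) : Prop :=
  [/\ forall i, smooth_on (target (atlas M i)) (P i),
      forall i x, target (atlas M i) x -> (P i x)^T = - P i x &
      forall i j x, overlap (atlas M i) (atlas M j) x ->
        P j (transition (atlas M i) (atlas M j) x) =
        ('J (transition (atlas M i) (atlas M j)) x)^T *m P i x *m
          'J (transition (atlas M i) (atlas M j)) x].

Definition vf_apply (X : vcomponents) (f : M -> R) (p : M) : R :=
  let i := chart_at p in
  let x := coord (atlas M i) p in
  'D_(X i x) (f \o param (atlas M i)) x.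

Definition bv_apply (P : bcomponents) (f g : M -> R) (p : M) : R :=
  let i := chart_at p in
  let x := coord (atlas M i) p in
  \sum_(a < d) \sum_(b < d)
    P i x a b * 'D_(dvec a) (f \o param (atlas M i)) x
              * 'D_(dvec b) (g \o param (atlas M i)) x.

End Fields.

Section Multivectors.
Context {R : realType} {d : nat}.

(* The exterior algebra of R^d: [a S] is the coefficient of [a] on
   [d_(i1) /\ ... /\ d_(ik)], where [i1 < ... < ik] are the elements of [S]. *)
Definition multivector := {ffun {set 'I_d} -> R}.

(* [d_A /\ d_B = (-1) ^ (inversions A B) d_(A :|: B)] for disjoint [A], [B]. *)
Definition inversions (A B : {set 'I_d}) : nat :=
  #|[pred p : 'I_d * 'I_d | [&& p.1 \in A, p.2 \in B & (p.2 < p.1)%N]]|.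

Definition wedge (a b : multivector) : multivector :=
  [ffun S : {set 'I_d} => \sum_(A : {set 'I_d} | A \subset S)
     (-1) ^+ inversions A (S :\: A)%SET * a A * b (S :\: A)%SET].

Definition mv1 : multivector := [ffun S : {set 'I_d} => (S == finset.set0)%:R].

Definition wedge_pow (a : multivector) (n : nat) : multivector :=
  iter n (wedge a) mv1.

Definition mv_of_vec (v : 'rV[R]_d) : multivector :=
  [ffun S : {set 'I_d} => \sum_(i < d | S == [set i]%SET) v 0 i].

Definition mv_of_bivec (P : 'M[R]_d) : multivector :=
  \sum_(i < d) \sum_(j < d | (i < j)%N)
     wedge (mv_of_vec (P i j *: dvec i)) (mv_of_vec (dvec j)).

(* the matrix of the bivector [u /\ v] *)
Definition bivec (u v : 'rV[R]_d) : 'M[R]_d := u^T *m v - v^T *m u.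

Definition lie_bracket (X Y : 'rV[R]_d -> 'rV[R]_d) (x : 'rV[R]_d) : 'rV[R]_d :=
  'D_(X x) Y x - 'D_(Y x) X x.

Definition schouten_dec (X1 X2 Y1 Y2 : 'rV[R]_d -> 'rV[R]_d) (x : 'rV[R]_d)
    : multivector :=
  let w3 (U V W : 'rV[R]_d) :=
    wedge (wedge (mv_of_vec U) (mv_of_vec V)) (mv_of_vec W) in
    w3 (lie_bracket X1 Y1 x) (X2 x) (Y2 x)
  - w3 (lie_bracket X1 Y2 x) (X2 x) (Y1 x)
  - w3 (lie_bracket X2 Y1 x) (X1 x) (Y2 x)
  + w3 (lie_bracket X2 Y2 x) (X1 x) (Y1 x).

(* R-bilinear extension of [schouten_dec], applied to the decompositions
   [P = sum_(i < j) (P i j d_i) /\ d_j] and [Q = sum_(k < l) (Q k l d_k) /\ d_l] *)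
Definition schouten (P Q : 'rV[R]_d -> 'M[R]_d) (x : 'rV[R]_d) : multivector :=
  \sum_(i < d) \sum_(j < d | (i < j)%N) \sum_(k < d) \sum_(l < d | (k < l)%N)
    schouten_dec (fun y => P y i j *: dvec i) (fun=> dvec j)
                 (fun y => Q y k l *: dvec k) (fun=> dvec l) x.

(* [L_X (Y1 /\ Y2) = [X, Y1] /\ Y2 + Y1 /\ [X, Y2]], extended to sums *)
Definition lie_bivec (X : 'rV[R]_d -> 'rV[R]_d) (P : 'rV[R]_d -> 'M[R]_d)
    (x : 'rV[R]_d) : multivector :=
  \sum_(i < d) \sum_(j < d | (i < j)%N)
   (wedge (mv_of_vec (lie_bracket X (fun y => P y i j *: dvec i) x))
          (mv_of_vec (dvec j))
  + wedge (mv_of_vec (P x i j *: dvec i))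
          (mv_of_vec (lie_bracket X (fun=> dvec j) x))).

End Multivectors.
Arguments multivector : clear implicits.

Section Jacobi.
Context {R : realType}.

Definition jacobi_structure (d : nat) (M : manifold R d)
    (P : bcomponents M) (E : vcomponents M) : Prop :=
  [/\ bivector_field P, vector_field E &
      forall i x, target (atlas M i) x ->
        schouten (P i) (P i) x =
          wedge (mv_of_vec (E i x)) (mv_of_bivec (P i x)) *+ 2 /\
        lie_bivec (E i) (P i) x = 0].

Definition contact_structure (d : nat) (M : manifold R d)
    (P : bcomponents M) (E : vcomponents M) : Prop :=
  jacobi_structure P E /\
  exists2 n : nat, d = n.*2.+1 &
    forall i x, target (atlas M i) x ->
      wedge (mv_of_vec (E i x)) (wedge_pow (mv_of_bivec (P i x)) n) <> 0.

Definition jacobi_morphism (d d' : nat) (S : manifold R d) (M : manifold R d')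
    (PS : bcomponents S) (ES : vcomponents S)
    (P : bcomponents M) (E : vcomponents M) (phi : S -> M) : Prop :=
  [/\ smooth_map phi,
      forall f : M -> R, smooth_function f ->
        vf_apply ES (f \o phi) = vf_apply E f \o phi &
      forall f g : M -> R, smooth_function f -> smooth_function g ->
        bv_apply PS (f \o phi) (g \o phi) = bv_apply P f g \o phi].

Definition contact_resolution (d : nat) (S M : manifold R d)
    (PS : bcomponents S) (ES : vcomponents S)
    (P : bcomponents M) (E : vcomponents M) (phi : S -> M) : Prop :=
  [/\ contact_structure PS ES,
      jacobi_morphism PS ES P E phi &
      forall m : M, exists s : S, phi s = m].

Definition admits_contact_resolution (d : nat) (M : manifold R d)
    (P : bcomponents M) (E : vcomponents M) : Prop :=
  exists (S : manifold R d) (PS : bcomponents S) (ES : vcomponents S)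
         (phi : S -> M), contact_resolution PS ES P E phi.

End Jacobi.

Section Euclidean.
Context (R : realType) (d : nat).

Lemma rV_second_countable : @second_countable 'rV[R]_d.
Proof.
pose b (qm : 'rV[rat]_d * nat) : set 'rV[R]_d :=
  ball (map_mx (fun q => ratr q : R) qm.1) qm.2.+1%:R^-1.
exists (range b); first exact: card_le_trans (card_image_le _ _) (countableP _).
split.
  by move=> _ [qm _ <-]; apply: ball_open; rewrite invr_gt0 ltr0n.
move=> x A /nbhs_ballP[e /= e0 xeA].
have [m me] : exists m, m.+1%:R^-1 < e / 2.
  have e20 : 0 < e / 2 by rewrite divr_gt0.
  have /= [m _ h] := near_infty_natSinv_lt (PosNum e20).
  by exists m; exact: (h m (leqnn m)).
have q_ex (i : 'I_d) : exists q : rat, `|x 0 i - ratr q| < m.+1%:R^-1.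
  have m0 : 0 < m.+1%:R^-1 :> R by rewrite invr_gt0 ltr0n.
  have : x 0 i - m.+1%:R^-1 < x 0 i + m.+1%:R^-1.
    by rewrite ltrD2l (lt_trans _ m0) // oppr_lt0.
  move=> /rat_in_itvoo[q]; rewrite in_itv/= => /andP[h1 h2].
  by exists q; rewrite distrC ltr_distl h1.
pose q : 'rV[rat]_d := \row_i sval (cid (q_ex i)).
have xq : ball (map_mx (fun q => ratr q : R) q) m.+1%:R^-1 x.
  by split=> [|i j]; rewrite ?invr_gt0 ?ltr0n// ord1 !mxE; apply: ball_sym; exact: (svalP (cid (q_ex j))).
exists (b (q, m)); first by split => //; exists (q, m).
move=> y qy; apply: xeA; rewrite [e]splitr.
have le2 : m.+1%:R^-1 <= e / 2 by exact: ltW.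
by apply: (ball_triangle (le_ball le2 (ball_sym xq))); exact: le_ball le2 _ qy.
Qed.

Definition id_chart : chart R d 'rV[R]_d :=
  @Chart R d 'rV[R]_d setT setT id id openT openT (fun _ => id) (fun _ => id)
    (fun _ _ => erefl) (fun _ _ => erefl)
    (fun _ _ => cvg_id) (fun _ _ => cvg_id).

Lemma Ck_cst (W : normedModType R) k U (w : W) : Ck k U (fun _ : 'rV[R]_d => w).
Proof.
elim: k w => [|k IH] w; first by move=> x _; exact: cst_continuous.
split=> [x _|i]; first exact: differentiable_cst.
rewrite [X in Ck k U X](_ : _ = fun=> 0); first exact: IH.
by apply/funext => x; rewrite derive_cst.
Qed.

Lemma smooth_id U : smooth_on U (@id 'rV[R]_d).
Proof.
case=> [|k]; first by move=> x _.
split=> [x _|i]; first by have [] := is_diff_id x.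
rewrite [X in Ck k U X](_ : _ = fun=> dvec i); first exact: Ck_cst.
by apply/funext => x; rewrite derive_id.
Qed.

Definition euclidean : manifold R d :=
  @Manifold R d 'rV[R]_d (@norm_hausdorff _ _) rV_second_countable
    unit (fun=> id_chart) (fun=> tt) (fun=> I) (fun _ _ => @smooth_id _).

End Euclidean.

Section Example.
Context (R : realType).

Local Notation x_ p := ((p : 'rV[R]_3) 0 0).
Local Notation y_ p := ((p : 'rV[R]_3) 0 1).

Local Notation d_x := (@dvec R 3 0).
Local Notation d_y := (@dvec R 3 1).
Local Notation d_z := (@dvec R 3 2).

Definition example_pi : bcomponents (euclidean R 3) := fun _ p =>
    (x_ p ^+ 4 + y_ p ^+ 4) *: bivec d_x d_y
  + x_ p *: bivec d_z d_x
  - y_ p *: bivec d_y d_z.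

Definition example_E : vcomponents (euclidean R 3) := fun _ _ => 2 *: d_z.

End Example.
Arguments example_pi : clear implicits.
Arguments example_E : clear implicits.

(* Main.v *)
Require Import Defs.
From HB Require Import structures.
From mathcomp Require Import all_boot all_order all_algebra.
From mathcomp Require Import all_classical all_reals all_analysis.
From mathcomp Require Import ring lra.
Import Order.TTheory GRing.Theory Num.Theory.
Import numFieldNormedType.Exports.

Set Implicit Arguments.
Unset Strict Implicit.
Unset Printing Implicit Defensive.

Local Open Scope classical_set_scope.
Local Open Scope ring_scope.

(** The source of the resolution is R^3 with coordinates (s, t, z) and the map
    is polynomial.

    Write pi = f d_x /\ d_y + d_z /\ W, where f = x^4 + y^4 and W is the Euler
    field x d_x + y d_y.  A pair (F d_0 /\ d_1 + d_2 /\ W, 2 d_2), with F a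
    function of the first two coordinates and W a field in them, is Jacobi as
    soon as L_W (F d_0 /\ d_1) = 2 F d_0 /\ d_1; for W = a x_0 d_0 + b x_1 d_1
    this is the Euler equation W(F) = (a + b + 2) F ([jacobi_planar_lift]).  It
    is contact exactly where F does not vanish ([contact_planar_lift]).  For pi,
    a = b = 1 and f is homogeneous of degree 4, so pi is Jacobi and is
    degenerate along the axis x = y = 0 only.  It remains to resolve the planar
    Poisson structure f d_x /\ d_y by a symplectic plane, together with the
    field W.

    In polar coordinates the symplectic form (dx /\ dy) / f is
    dr /\ dtheta / (r^3 g(theta)) with g(theta) = cos^4 + sin^4, and the pole
    in r disappears after the substitution theta = r^3 t.  The same works with
    any parametrization u |-> (p(u), q(u)) of the directions of the plane
    instead of the angle: put (x, y) = s (p(u), q(u)) and u = s^3 t.  Then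
    dx /\ dy = s^4 (p q' - q p')(u) ds /\ dt and f = s^4 (p^4 + q^4)(u), so
    the bivector G(u) d_s /\ d_t with G = (p^4 + q^4) / (p q' - q p') is carried
    to f d_x /\ d_y.  As s takes both signs, it is enough that (p, q) meets
    every line through the origin; with p = 1 - u^4 and q = 2 u (1 + u^2),
    which is the rational parametrization of the circle times (1 + u^2)^2, one
    gets p q' - q p' = 2 (1 + u^2)^3 and the polynomial
    G = (1 + u^2) ((1 - u^2)^4 + 16 u^4) / 2, positive everywhere.

    The field that lifts W has to scale s while it fixes u, hence it is
    s d_s - 3 t d_t.  The function G(u) is constant along it and
    a + b + 2 = 1 - 3 + 2 = 0, so the Euler equation holds upstairs
    ([contact_resolution_source]).  The map (s, t, z) |-> (x, y, z) is then a
    Jacobi morphism, because its differential carries the bivector and the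
    vector field upstairs to those of the target ([pi_resolution],
    [Reeb_resolution], [jacobi_morphism_euclidean]), and it is onto because
    every point of the plane is on a line of direction (p(u), q(u))
    ([resolution_surj]). *)

(** * Smooth functions on R^d *)

Section SmoothAlgebra.
Context {R : realType} {d : nat}.
Implicit Types (W : normedModType R) (k : nat) (f g : 'rV[R]_d -> R).

Lemma Ck_sub W k (U V : set 'rV[R]_d) (f : 'rV[R]_d -> W) :
  U `<=` V -> Ck k V f -> Ck k U f.
Proof.
move=> UV; elim: k f => [|k IH] f /=; first by move=> fV x /UV /fV.
by move=> [df Df]; split=> [x /UV /df //|i]; exact: IH.
Qed.

Lemma CkW W k (U : set 'rV[R]_d) (f : 'rV[R]_d -> W) :
  Ck k.+1 U f -> Ck k U f.
Proof.
elim: k f => [|k IH] f [df Df].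
  by move=> x /df; exact: differentiable_continuous.
by split=> // i; exact: IH.
Qed.

Lemma Ck_diff W k (f : 'rV[R]_d -> W) x : Ck k.+1 setT f -> differentiable f x.
Proof. by case=> + _; exact. Qed.

Lemma CkD W k (f g : 'rV[R]_d -> W) :
  Ck k setT f -> Ck k setT g -> Ck k setT (fun x => f x + g x).
Proof.
elim: k f g => [|k IH] f g fk gk.
  by move=> x _; apply: continuousD; [exact: fk|exact: gk].
split=> [x _|i].
  by apply: differentiableD; [exact: Ck_diff fk|exact: Ck_diff gk].
rewrite [X in Ck k _ X](_ : _ = fun x => 'D_(dvec i) f x + 'D_(dvec i) g x).
  by apply: IH; [exact: fk.2|exact: gk.2].
apply/funext => x.
by apply: deriveD; apply: diff_derivable; [exact: Ck_diff fk|exact: Ck_diff gk].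
Qed.

Lemma CkM k f g :
  Ck k setT f -> Ck k setT g -> Ck k setT (fun x => f x * g x).
Proof.
elim: k f g => [|k IH] f g fk gk.
  by move=> x _; apply: continuousM; [exact: fk|exact: gk].
split=> [x _|i].
  by apply: differentiableM; [exact: Ck_diff fk|exact: Ck_diff gk].
rewrite [X in Ck k _ X](_ : _ =
  fun x => f x * 'D_(dvec i) g x + g x * 'D_(dvec i) f x).
  have [fW gW] := (CkW fk, CkW gk).
  by apply: CkD; apply: IH => //; [exact: gk.2|exact: fk.2].
apply/funext => x.
by apply: deriveM; apply: diff_derivable; [exact: Ck_diff fk|exact: Ck_diff gk].
Qed.

(** The derivatives of a continuous linear map after [f] are that map after the
    derivatives of [f]; coordinates, opposites and multiples of a fixed vector
    are the instances used below. *)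
Lemma Ck_linear W (W' : normedModType R) k (L : W -> W')
    (f : 'rV[R]_d -> W) :
  linear L -> continuous L -> Ck k setT f -> Ck k setT (fun x => L (f x)).
Proof.
move=> Llin Lc.
pose LM := GRing.isLinear.Build _ _ _ _ _ Llin.
pose LL : {linear W -> W'} := HB.pack L LM.
have Ld y : differentiable L y by exact: (@linear_differentiable _ _ _ LL).
have dL y : 'd L y = L :> (W -> W') by exact: (@diff_lin _ _ _ LL).
elim: k f => [|k IH] f fk.
  by move=> x _; apply: (@continuous_comp _ _ _ f L); [exact: fk|exact: Lc].
split=> [x _ |i].
  by apply: (@differentiable_comp _ _ _ _ f L) => //; exact: Ck_diff fk.
rewrite [X in Ck k _ X](_ : _ = fun x => L ('D_(dvec i) f x)).
  by apply: IH; exact: fk.2.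
apply/funext => x; have fd := Ck_diff x fk.
rewrite deriveE; last by apply: (@differentiable_comp _ _ _ _ f L).
by rewrite (@diff_comp _ _ _ _ f L) //= dL deriveE.
Qed.

Lemma smooth_sub W (U V : set 'rV[R]_d) (f : 'rV[R]_d -> W) :
  U `<=` V -> smooth_on V f -> smooth_on U f.
Proof. by move=> UV fV k; exact: Ck_sub UV _. Qed.

Lemma smooth_cst W (w : W) : smooth_on setT (fun _ : 'rV[R]_d => w).
Proof. by move=> k; exact: Ck_cst. Qed.

Lemma smooth_coord (i : 'I_d) : smooth_on setT (fun x : 'rV[R]_d => x 0 i).
Proof.
move=> k; apply: (@Ck_linear _ _ k (fun x : 'rV[R]_d => x 0 i : R) id).
- by move=> a u v; rewrite !mxE.
- exact: coord_continuous.
- exact: smooth_id.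
Qed.

Lemma smoothD W (f g : 'rV[R]_d -> W) :
  smooth_on setT f -> smooth_on setT g -> smooth_on setT (fun x => f x + g x).
Proof. by move=> fs gs k; exact: CkD. Qed.

Lemma smoothM f g :
  smooth_on setT f -> smooth_on setT g -> smooth_on setT (fun x => f x * g x).
Proof. by move=> fs gs k; exact: CkM. Qed.

Lemma smoothX n f :
  smooth_on setT f -> smooth_on setT (fun x => f x ^+ n).
Proof.
move=> fs; elim: n => [|n IH]; first exact: smooth_cst.
under eq_fun do rewrite exprS.
exact: smoothM.
Qed.

Lemma smoothN W (f : 'rV[R]_d -> W) :
  smooth_on setT f -> smooth_on setT (fun x => - f x).
Proof.
move=> fs k; apply: (@Ck_linear _ _ k -%R) => //; last exact: opp_continuous.
by move=> a u v; rewrite opprD scalerN.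
Qed.

Lemma smoothZl W f (w : W) :
  smooth_on setT f -> smooth_on setT (fun x => f x *: w).
Proof.
move=> fs k; apply: (@Ck_linear R^o W k (fun a : R => a *: w)) => //.
  by move=> a u v; rewrite scalerDl scalerA.
exact: scalel_continuous.
Qed.

Lemma smooth_diff W (f : 'rV[R]_d -> W) x :
  smooth_on setT f -> differentiable f x.
Proof. by move=> fs; exact: (Ck_diff x (fs 1%N)). Qed.

Lemma smooth_continuous W (f : 'rV[R]_d -> W) :
  smooth_on setT f -> continuous f.
Proof. by move=> fs x; exact: (fs 0%N). Qed.

Lemma derive_scalel W (w : W) (h : 'rV[R]_d -> R) (x v : 'rV[R]_d) :
  differentiable h x -> 'D_v (fun y => h y *: w) x = 'D_v h x *: w.
Proof.
move=> hx; rewrite deriveE; last exact: differentiableZl.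
by rewrite diffZl // deriveE.
Qed.

Lemma deriveZdir W (h : 'rV[R]_d -> W) (x v : 'rV[R]_d) c :
  differentiable h x -> 'D_(c *: v) h x = c *: 'D_v h x.
Proof. by move=> hx; rewrite !deriveE // linearZ. Qed.

Lemma derive_coord (x v : 'rV[R]_d) i :
  'D_v (fun y : 'rV[R]_d => y 0 i) x = v 0 i.
Proof.
rewrite deriveE; last exact: differentiable_coord.
pose L := fun y : 'rV[R]_d => y 0 i : R.
have Llin : linear L by move=> a u w; rewrite /L !mxE.
pose LM := GRing.isLinear.Build _ _ _ _ _ Llin.
pose LL : {linear 'rV[R]_d -> R} := HB.pack L LM.
by rewrite (@diff_lin _ _ _ LL) //; exact: coord_continuous.
Qed.

Lemma derive_coordM c i (v x : 'rV[R]_d) :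
  'D_v (fun y : 'rV[R]_d => c * y 0 i) x = c * v 0 i.
Proof.
rewrite -(derive_coord x v i).
rewrite (_ : (fun y => _) = c \*: (fun y : 'rV[R]_d => y 0 i)) //.
by rewrite deriveZ //; apply: diff_derivable; exact: differentiable_coord.
Qed.

Lemma differentiable_entry m n (P : 'rV[R]_d -> 'M[R]_(m, n)) x i j :
  differentiable P x -> differentiable (fun y => P y i j) x.
Proof.
move=> Px.
apply: (@differentiable_comp _ _ _ _ P
  (fun M : 'M[R]_(m, n) => M i j : R)) => //.
exact: differentiable_coord.
Qed.

End SmoothAlgebra.

(** The rules of differentiation for functions written pointwise, so that the
    derivative of a polynomial is an explicit term built along its syntax. *)
Section PointwiseRules.
Context {R : realType} {d : nat}.
Implicit Types (x v : 'rV[R]_d) (f g : 'rV[R]_d -> R).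

Lemma is_derive_coord x v i : is_derive x v (fun y : 'rV[R]_d => y 0 i) (v 0 i).
Proof.
rewrite -(derive_coord x v i); apply: derivableP; apply: diff_derivable.
exact: differentiable_coord.
Qed.

Lemma is_derive_add f g x v df dg : is_derive x v f df -> is_derive x v g dg ->
  is_derive x v (fun y => f y + g y) (df + dg).
Proof. exact: is_deriveD. Qed.

Lemma is_derive_mul f g x v df dg : is_derive x v f df -> is_derive x v g dg ->
  is_derive x v (fun y => f y * g y) (f x * dg + g x * df).
Proof. exact: is_deriveM. Qed.

Lemma is_derive_pow f n x v df : is_derive x v f df ->
  is_derive x v (fun y => f y ^+ n.+1) (n.+1%:R * f x ^+ n * df).
Proof. by move=> hf; rewrite -exprfctE; exact: is_deriveX. Qed.

Lemma is_derive_const (c : R) x v : is_derive x v (fun=> c) 0.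
Proof. exact: is_derive_cst. Qed.

Lemma is_derive_opp f x v df : is_derive x v f df ->
  is_derive x v (fun y => - f y) (- df).
Proof. exact: is_deriveN. Qed.

End PointwiseRules.

(** * The exterior algebra in dimension three *)

Section ExteriorAlgebra.
Context {R : realType} {d : nat}.
Implicit Types (a b c : multivector R d) (S A B : {set 'I_d}).

Lemma wedgeDr a b c : wedge a (b + c) = wedge a b + wedge a c.
Proof.
apply/ffunP => S; rewrite !ffunE -big_split; apply: eq_bigr => A _ /=.
by rewrite ffunE mulrDr.
Qed.

Lemma wedge1r a : wedge a (mv1 : multivector R d) = a.
Proof.
apply/ffunP => S; rewrite ffunE (bigD1 S) //= finset.setDv ffunE eqxx mulr1.
rewrite /inversions eq_card0 ?expr0 ?mul1r; last first.
  by move=> p; rewrite !inE andbF.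
rewrite big1 ?addr0 // => A /andP[AS AneS].
rewrite ffunE finset.setD_eq0 (_ : (S \subset A) = false) ?mulr0 //.
by apply: contra_neqF AneS => SA; apply/eqP; rewrite finset.eqEsubset AS.
Qed.

Lemma inversionsE A B :
  inversions A B = (\sum_(j in A) \sum_(i in B) (i < j))%N.
Proof.
rewrite /inversions pair_big /= -sum1_card big_mkcond [RHS]big_mkcond.
apply: eq_bigr => p _ /=.
by rewrite !inE; do 2![case: (_ \in _) => //=]; case: (_ < _)%N.
Qed.

(** Only the subsets that omit exactly one element of [S] contribute; together
    with [wedge_vecl], this turns a wedge of vectors into a sum over indices. *)
Lemma wedge_vecr a (v : 'rV[R]_d) S :
  wedge a (mv_of_vec v) S =
  \sum_(i in S) (-1) ^+ (\sum_(j in S) (i < j)%N) * a (S :\ i)%SET * v 0 i.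
Proof.
rewrite ffunE; under eq_bigr => A _ do rewrite ffunE mulr_sumr.
rewrite (exchange_big_dep xpredT) //= [RHS]big_mkcond; apply: eq_bigr => i _.
case: ifPn => [iS|iNS]; last first.
  rewrite big1 // => A /andP[_ /eqP SA].
  by have := set11 i; rewrite -SA inE (negPf iNS) andbF.
rewrite (bigD1 (S :\ i)%SET) /=; last first.
  rewrite subsetDl /=; apply/eqP/setP => j; rewrite !inE.
  by have [->|] := eqVneq j i; rewrite ?iS //= andNb.
rewrite big1 => [|A /andP[/andP[AS /eqP SA] /eqP]]; last first.
  case; apply/setP => j; move/setP/(_ j): SA; rewrite !inE => <-.
  have [jA|] := boolP (j \in A); last by case: (j \in S).
  by rewrite (fintype.subsetP AS).
have -> : (S :\: (S :\ i) = [set i])%SET.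
  apply/setP => j; rewrite !inE.
  by have [->|] := eqVneq j i; rewrite ?iS //= andNb.
rewrite addr0 inversionsE; congr (_ ^+ _ * _ * _).
under eq_bigr do rewrite big_set1.
by rewrite [RHS](big_setD1 i) //= ltnn.
Qed.

Lemma wedge_vecl a (v : 'rV[R]_d) S :
  wedge (mv_of_vec v) a S =
  \sum_(i in S) (-1) ^+ (\sum_(j in S) (j < i)%N) * v 0 i * a (S :\ i)%SET.
Proof.
rewrite ffunE; under eq_bigr => A _ do rewrite ffunE mulr_sumr mulr_suml.
rewrite (exchange_big_dep xpredT) //= [RHS]big_mkcond; apply: eq_bigr => i _.
case: ifPn => [iS|iNS]; last first.
  rewrite big1 // => A /andP[+ /eqP SA].
  by rewrite SA finset.sub1set (negPf iNS).
rewrite (bigD1 [set i]%SET) /= ?eqxx ?andbT ?finset.sub1set //.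
rewrite big1 ?addr0 => [|A /andP[/andP[_ ->]] //].
rewrite inversionsE big_set1; congr (_ ^+ _ * _ * _).
by rewrite [RHS](big_setD1 i) //= ltnn.
Qed.

Definition homogeneous n a := forall S, #|S| != n -> a S = 0.

Lemma homogeneous_vec (v : 'rV[R]_d) : homogeneous 1 (mv_of_vec v).
Proof.
move=> S S1; rewrite ffunE big1 // => i /eqP SE.
by move: S1; rewrite SE cards1.
Qed.

Lemma homogeneous_wedge m n a b :
  homogeneous m a -> homogeneous n b -> homogeneous (m + n) (wedge a b).
Proof.
move=> ha hb S Smn; rewrite ffunE big1 // => A AS.
have [Am|/ha ->] := eqVneq #|A| m; last by rewrite mulr0 mul0r.
rewrite hb ?mulr0 //; apply: contra_neq Smn => Bn.
by rewrite -Am -Bn -(cardsID A S) (finset.setIidPr AS).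
Qed.

Lemma mv_of_vec0 : mv_of_vec (0 : 'rV[R]_d) = 0.
Proof. by apply/ffunP => S; rewrite !ffunE big1 // => i _; rewrite mxE. Qed.

Lemma wedge0l a : wedge 0 a = 0.
Proof.
apply/ffunP => S; rewrite !ffunE big1 // => A _.
by rewrite ffunE mulr0 mul0r.
Qed.

Lemma wedge0r a : wedge a 0 = 0.
Proof.
by apply/ffunP => S; rewrite !ffunE big1 // => A _; rewrite ffunE mulr0.
Qed.

End ExteriorAlgebra.

Section ThreeDim.
Context {R : realType}.

Lemma big_ord3 (V : nmodType) (F : 'I_3 -> V) :
  \sum_(i < 3) F i = F 0 + F 1 + F 2.
Proof.
rewrite !big_ord_recl big_ord0 addr0 addrA.
by congr (F _ + F _ + F _); exact: val_inj.
Qed.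

Definition det3 (u v w : 'rV[R]_3) : R :=
    u 0 0 * (v 0 1 * w 0 2 - v 0 2 * w 0 1)
  - u 0 1 * (v 0 0 * w 0 2 - v 0 2 * w 0 0)
  + u 0 2 * (v 0 0 * w 0 1 - v 0 1 * w 0 0).

(** The multivector [c d_0 /\ d_1 /\ d_2]. *)
Definition vol (c : R) : multivector R 3 :=
  [ffun S : {set 'I_3} => c *+ (S == finset.setT)].

Lemma volD a b : vol a + vol b = vol (a + b).
Proof. by apply/ffunP => S; rewrite !ffunE mulrnDl. Qed.

Lemma volN a : - vol a = vol (- a).
Proof. by apply/ffunP => S; rewrite !ffunE mulNrn. Qed.

Lemma vol_homogeneous (a : multivector R 3) :
  homogeneous 3 a -> a = vol (a finset.setT).
Proof.
move=> ha; apply/ffunP => S; rewrite ffunE.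
have [->//|ST] := eqVneq S finset.setT.
rewrite mulr0n; apply: ha; apply: contra_neq ST => S3; apply/eqP.
by rewrite eqEcard finset.subsetT cardsT card_ord S3.
Qed.

Lemma mv_of_vec1 (v : 'rV[R]_3) i : mv_of_vec v [set i]%SET = v 0 i.
Proof.
rewrite ffunE (bigD1 i) ?eqxx //= big1 ?addr0 // => j.
by move=> /andP[/eqP/finset.set1_inj ->]; rewrite eqxx.
Qed.

Lemma mv_of_vec_setD2 (v : 'rV[R]_3) (i j k : 'I_3) :
  i != j -> k != i -> k != j -> mv_of_vec v (finset.setT :\ i :\ j)%SET = v 0 k.
Proof.
move=> ij ki kj; rewrite -(mv_of_vec1 v k); congr (mv_of_vec v _).
apply/eqP; rewrite eq_sym eqEcard finset.sub1set !inE kj ki /= cards1.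
have := cardsD1 j (finset.setT :\ i)%SET; have := cardsD1 i [set: 'I_3]%SET.
rewrite !inE [j == i]eq_sym ij cardsT card_ord !add1n => -[<-] [<-].
by [].
Qed.

(** The product has degree three, so only its coefficient on the full index set
    matters; that one is the expansion of the determinant. *)
Lemma wedge3l (u v w : 'rV[R]_3) :
  wedge (wedge (mv_of_vec u) (mv_of_vec v)) (mv_of_vec w) = vol (det3 u v w).
Proof.
apply: etrans (vol_homogeneous _) _.
  apply: (@homogeneous_wedge _ _ 2 1); last exact: homogeneous_vec.
  by apply: (@homogeneous_wedge _ _ 1 1); exact: homogeneous_vec.
congr vol.
rewrite wedge_vecr big_mkcond big_ord3 !inE /=.
rewrite !wedge_vecr !(big_mkcond (fun i => i \in _)) !big_ord3 !inE /=.
have e := mv_of_vec_setD2 u.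
rewrite (e 0 1 2) // (e 1 0 2) // (e 0 2 1) //.
rewrite (e 2 0 1) // (e 1 2 0) // (e 2 1 0) //.
rewrite !(big_mkcond (fun i => i \in _)) !big_ord3 !inE /=.
by rewrite /det3; ring.
Qed.

Lemma wedge3r (u v w : 'rV[R]_3) :
  wedge (mv_of_vec u) (wedge (mv_of_vec v) (mv_of_vec w)) = vol (det3 u v w).
Proof.
apply: etrans (vol_homogeneous _) _.
  apply: (@homogeneous_wedge _ _ 1 2); first exact: homogeneous_vec.
  by apply: (@homogeneous_wedge _ _ 1 1); exact: homogeneous_vec.
congr vol.
rewrite wedge_vecl big_mkcond big_ord3 !inE /=.
rewrite !wedge_vecl !(big_mkcond (fun i => i \in _)) !big_ord3 !inE /=.
have e := mv_of_vec_setD2 w.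
rewrite (e 0 1 2) // (e 1 0 2) // (e 0 2 1) //.
rewrite (e 2 0 1) // (e 1 2 0) // (e 2 1 0) //.
rewrite !(big_mkcond (fun i => i \in _)) !big_ord3 !inE /=.
by rewrite /det3; ring.
Qed.

Lemma det3_alt (u v : 'rV[R]_3) :
  (det3 u u v = 0) * (det3 u v u = 0) * (det3 v u u = 0).
Proof. by split; [split|]; rewrite /det3; ring. Qed.

Lemma det3_perm (u v w : 'rV[R]_3) :
  (det3 u w v = - det3 u v w) * (det3 v u w = - det3 u v w) *
  (det3 v w u = det3 u v w) * (det3 w u v = det3 u v w) *
  (det3 w v u = - det3 u v w).
Proof. by do !split; rewrite /det3; ring. Qed.

Lemma det3_dvec : det3 (dvec 0) (dvec 1) (dvec 2) = 1 :> R.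
Proof. by rewrite /det3 !mxE /=; ring. Qed.

Lemma big_lt3 (V : nmodType) (G : 'I_3 -> 'I_3 -> V) :
  \sum_(i < 3) \sum_(j < 3 | (i < j)%N) G i j = G 0 1 + G 0 2 + G 1 2.
Proof.
by rewrite big_ord3 !(big_mkcond (fun j => _ < _)%N) !big_ord3 /= !add0r !addr0.
Qed.

Lemma mv_of_bivec3 (P : 'M[R]_3) :
  mv_of_bivec P =
  wedge (mv_of_vec (P 0 1 *: dvec 0)) (mv_of_vec (dvec 1)) +
  wedge (mv_of_vec (P 0 2 *: dvec 0)) (mv_of_vec (dvec 2)) +
  wedge (mv_of_vec (P 1 2 *: dvec 1)) (mv_of_vec (dvec 2)).
Proof. exact: big_lt3. Qed.

Lemma wedge_d2_bivec c (P : 'M[R]_3) :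
  wedge (mv_of_vec (c *: dvec 2)) (mv_of_bivec P) = vol (c * P 0 1).
Proof.
rewrite mv_of_bivec3 !wedgeDr !wedge3r !volD; congr vol.
by rewrite /det3 !mxE /=; ring.
Qed.

End ThreeDim.

(** * Schouten and Lie brackets in coordinates *)

Section Brackets.
Context {R : realType}.
Implicit Types (f g : 'rV[R]_3 -> R) (x : 'rV[R]_3) (P : 'rV[R]_3 -> 'M[R]_3).

Lemma schouten_decE (X1 X2 Y1 Y2 : 'rV[R]_3 -> 'rV[R]_3) x :
  schouten_dec X1 X2 Y1 Y2 x =
  vol (det3 (lie_bracket X1 Y1 x) (X2 x) (Y2 x)
     - det3 (lie_bracket X1 Y2 x) (X2 x) (Y1 x)
     - det3 (lie_bracket X2 Y1 x) (X1 x) (Y2 x)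
     + det3 (lie_bracket X2 Y2 x) (X1 x) (Y1 x)).
Proof.
rewrite -volD; congr (_ + _); last exact: wedge3l.
rewrite -[vol (_ - _ - _)]volD -[vol (_ - _)]volD -!volN.
by congr (_ - _ - _); exact: wedge3l.
Qed.

Lemma lie_bracket_scalel d (f g : 'rV[R]_d -> R) (v w x : 'rV[R]_d) :
  differentiable f x -> differentiable g x ->
  lie_bracket (fun y => f y *: v) (fun y => g y *: w) x =
  (f x * 'D_v g x) *: w - (g x * 'D_w f x) *: v.
Proof.
by move=> fx gx; rewrite /lie_bracket !derive_scalel // !deriveZdir.
Qed.

Lemma lie_bracket_scalel_cst d (f : 'rV[R]_d -> R) (v w x : 'rV[R]_d) :
  differentiable f x ->
  lie_bracket (fun y => f y *: v) (fun=> w) x = - ('D_w f x *: v).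
Proof.
by move=> fx; rewrite /lie_bracket derive_cst derive_scalel // sub0r.
Qed.

Lemma lie_bracket_cst_scalel d (f : 'rV[R]_d -> R) (v w x : 'rV[R]_d) :
  differentiable f x ->
  lie_bracket (fun=> w) (fun y => f y *: v) x = 'D_w f x *: v.
Proof.
by move=> fx; rewrite /lie_bracket derive_cst derive_scalel // subr0.
Qed.

Lemma lie_bracket_cst d (v w x : 'rV[R]_d) :
  lie_bracket (fun=> v) (fun=> w) x = 0.
Proof. by rewrite /lie_bracket !derive_cst subrr. Qed.

Lemma schouten_dec3 f g (i j k l : 'I_3) x :
  differentiable f x -> differentiable g x ->
  schouten_dec (fun y => f y *: dvec i) (fun=> dvec j)
               (fun y => g y *: dvec k) (fun=> dvec l) x =
  vol (f x * 'D_(dvec i) g x * det3 (dvec k) (dvec j) (dvec l)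
     - g x * 'D_(dvec k) f x * det3 (dvec i) (dvec j) (dvec l)
     + g x * 'D_(dvec l) f x * det3 (dvec i) (dvec j) (dvec k)
     - f x * 'D_(dvec j) g x * det3 (dvec k) (dvec i) (dvec l)).
Proof.
move=> fx gx; rewrite schouten_decE lie_bracket_cst.
rewrite lie_bracket_scalel // lie_bracket_scalel_cst //.
rewrite lie_bracket_cst_scalel //.
congr vol.
(* An identity between polynomials in the values, the derivatives and the
   coordinates of the four vectors. *)
move: ('D_(dvec i) g x) ('D_(dvec j) g x) ('D_(dvec k) f x) ('D_(dvec l) f x).
move: (dvec i) (dvec j) (dvec k) (dvec l) (f x) (g x).
move=> ei ej ek el fx' gx' gi gj fk fl; rewrite /det3 !mxE; ring.
Qed.

(** Up to the factor 2, the coefficient is the Jacobiator of [P], the cyclic sum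
    over (i, j, k) of [\sum_l P i l * d_l (P j k)]. *)
Lemma schouten3 P x :
  differentiable P x ->
  schouten P P x =
  vol (2 * (P x 0 1 * ('D_(dvec 0) (fun y => P y 0 2) x
                       + 'D_(dvec 1) (fun y => P y 1 2) x)
          + P x 0 2 * ('D_(dvec 2) (fun y => P y 1 2) x
                       - 'D_(dvec 0) (fun y => P y 0 1) x)
          - P x 1 2 * ('D_(dvec 1) (fun y => P y 0 1) x
                       + 'D_(dvec 2) (fun y => P y 0 2) x))).
Proof.
move=> Pdx; have Px i j := differentiable_entry i j Pdx.
rewrite /schouten big_lt3 !big_lt3.
rewrite !(schouten_dec3 _ _ _ _ (Px _ _) (Px _ _)).
(* Naming the partial derivatives keeps the comparison of the monomials below
   from unfolding their definition. *)
have [D DE] : exists D : 'I_3 -> 'I_3 -> 'I_3 -> R,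
    forall i j k, 'D_(dvec i) (fun y => P y j k) x = D i j k by eexists.
rewrite !DE.
rewrite !volD; congr vol.
have e := det3_dvec; have p := det3_perm (@dvec R 3 0) (dvec 1) (dvec 2).
by rewrite !det3_alt !p e; ring.
Qed.

(** Bracketing with a constant field only differentiates the coefficients. *)
Lemma lie_bivec_cst d (e : 'rV[R]_d) (P : 'rV[R]_d -> 'M[R]_d)
    (x : 'rV[R]_d) :
  differentiable P x -> 'D_e P x = 0 -> lie_bivec (fun=> e) P x = 0.
Proof.
move=> Px De; rewrite /lie_bivec big1 // => i _; rewrite big1 // => j _.
rewrite lie_bracket_cst mv_of_vec0 wedge0r addr0.
rewrite lie_bracket_cst_scalel; last first.
  exact: differentiable_entry.
have := derive_mx (diff_derivable (v := e) Px); rewrite De => /matrixP/(_ i j).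
by rewrite !mxE => <-; rewrite scale0r mv_of_vec0 wedge0l.
Qed.

End Brackets.

(** * Tensor fields and Jacobi morphisms between Euclidean spaces *)

Section EuclideanFields.
Context {R : realType} {d : nat}.
Local Notation E := (euclidean R d).

Lemma jacobian_id (x : 'rV[R]_d) : 'J (@id 'rV[R]_d) x = 1%:M.
Proof.
apply/row_matrixP => i; rewrite !rowE mulmx1 mul_rV_lin1.
by rewrite diff_val.
Qed.

Lemma jacobian_transition i j (x : 'rV[R]_d) :
  'J (transition (atlas E i) (atlas E j)) x = 1%:M.
Proof. exact: jacobian_id. Qed.

Lemma vector_field_euclidean (X : 'rV[R]_d -> 'rV[R]_d) :
  smooth_on setT X -> @vector_field R d E (fun=> X).
Proof.
by move=> Xs; split=> [_ //|i j x _]; rewrite jacobian_transition mulmx1.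
Qed.

Lemma bivector_field_euclidean (P : 'rV[R]_d -> 'M[R]_d) :
  smooth_on setT P -> (forall x, (P x)^T = - P x) ->
  @bivector_field R d E (fun=> P).
Proof.
move=> Ps Pa; split=> [_ //|_ x _ //|i j x _]; rewrite jacobian_transition.
by rewrite trmx1 mul1mx mulmx1.
Qed.

Lemma trmx_bivec (u v : 'rV[R]_d) : (bivec u v)^T = - bivec u v.
Proof. by rewrite /bivec linearB /= !trmx_mul !trmxK opprB. Qed.

Lemma bivecE (u v : 'rV[R]_d) i j :
  bivec u v i j = u 0 i * v 0 j - v 0 i * u 0 j.
Proof. by rewrite !mxE !big_ord1 !mxE. Qed.

Lemma bivec_push m (u v : 'rV[R]_d) (A : 'M[R]_(d, m)) :
  A^T *m bivec u v *m A = bivec (u *m A) (v *m A).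
Proof. by rewrite /bivec mulmxBr mulmxBl !trmx_mul !mulmxA. Qed.

(** The effect of a map that changes the first two vectors of a frame among
    themselves on a bivector [c e_0 /\ e_1 + e_2 /\ w]: the planar part is
    multiplied by the determinant, and [w] is pushed forward. *)
Lemma bivec_frame (e0 e1 e2 : 'rV[R]_d) (c a b p q p' q' : R) :
  c *: bivec (p *: e0 + q *: e1) (p' *: e0 + q' *: e1)
  + a *: bivec e2 (p *: e0 + q *: e1) + b *: bivec e2 (p' *: e0 + q' *: e1) =
  (c * (p * q' - q * p')) *: bivec e0 e1 + (a * p + b * p') *: bivec e2 e0
  + (a * q + b * q') *: bivec e2 e1.
Proof.
have mxD (A B : 'M[R]_d) i j : (A + B) i j = A i j + B i j by rewrite mxE.
have mxZ k (A : 'M[R]_d) i j : (k *: A) i j = k * A i j by rewrite mxE.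
by apply/matrixP => i j; rewrite !(mxD, mxZ, bivecE) !mxE; ring.
Qed.

End EuclideanFields.

Section EuclideanMorphism.
Context {R : realType} {d d' : nat}.
Implicit Types (phi : 'rV[R]_d -> 'rV[R]_d') (x v : 'rV[R]_d).

Definition gradient n (f : 'rV[R]_n -> R) (x : 'rV[R]_n) : 'cV[R]_n :=
  \col_i 'D_(dvec i) f x.

Lemma derive_gradient n (f : 'rV[R]_n -> R) (x v : 'rV[R]_n) :
  differentiable f x -> 'D_v f x = (v *m gradient f x) 0 0.
Proof.
move=> fx; rewrite deriveE // [v in LHS]row_sum_delta linear_sum mxE.
apply: eq_bigr => i _; rewrite linearZ mxE /= deriveE //.
Qed.

Lemma gradient_comp phi (f : 'rV[R]_d' -> R) x :
  differentiable phi x -> differentiable f (phi x) ->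
  gradient (f \o phi) x = 'J phi x *m gradient f (phi x).
Proof.
move=> phix fx; apply/colP => i; rewrite mxE.
rewrite deriveE; last exact: differentiable_comp.
rewrite diff_comp //= -!deriveE // derive_gradient // deriveEjacobian //.
by rewrite -mulmxA mulmxA -rowE -row_mul mxE.
Qed.

(** Both sides of the morphism conditions are linear in the gradients of the
    test functions, and the chain rule multiplies a gradient by the Jacobian
    matrix, so relatedness of the tensors at each point suffices. *)
Lemma jacobi_morphism_euclidean phi
    (PS : 'rV[R]_d -> 'M[R]_d) (ES : 'rV[R]_d -> 'rV[R]_d)
    (P : 'rV[R]_d' -> 'M[R]_d') (E : 'rV[R]_d' -> 'rV[R]_d') :
  smooth_on setT phi ->
  (forall x, ES x *m 'J phi x = E (phi x)) ->
  (forall x, ('J phi x)^T *m PS x *m 'J phi x = P (phi x)) ->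
  @jacobi_morphism R d d' (euclidean R d) (euclidean R d')
    (fun=> PS) (fun=> ES) (fun=> P) (fun=> E) phi.
Proof.
move=> phis hE hP.
have phid x : differentiable phi x by exact: smooth_diff.
split.
- split; first exact: smooth_continuous.
  by move=> i j; exact: smooth_sub phis.
- move=> f fs; apply/funext => x.
  have fd y : differentiable f y by exact: smooth_diff (fs tt).
  have fphid : differentiable (f \o phi) x by exact: differentiable_comp.
  change ('D_(ES x) (f \o phi) x = 'D_(E (phi x)) f (phi x)).
  by rewrite !derive_gradient // gradient_comp // mulmxA hE.
move=> f g fs gs; apply/funext => x.
(* The pairing of two differentials with a bivector is a matrix product. *)
have bvE n (Q : 'M[R]_n) (h k : 'rV[R]_n -> R) (y : 'rV[R]_n) :
    \sum_(a < n) \sum_(b < n) Q a b * 'D_(dvec a) h y * 'D_(dvec b) k y =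
    ((gradient h y)^T *m Q *m gradient k y) 0 0.
  rewrite mxE exchange_big; apply: eq_bigr => b _ /=.
  rewrite !mxE mulr_suml; apply: eq_bigr => a _ /=.
  by rewrite !mxE [_ * Q a b]mulrC.
apply: etrans (bvE _ _ _ _ _) _; apply: etrans _ (esym (bvE _ _ _ _ _)) => /=.
have fd y : differentiable f y by exact: smooth_diff (fs tt).
have gd y : differentiable g y by exact: smooth_diff (gs tt).
rewrite [gradient (f \o phi) _]gradient_comp //.
rewrite [gradient (g \o phi) _]gradient_comp //.
by rewrite trmx_mul -hP !mulmxA.
Qed.

End EuclideanMorphism.

(** * Jacobi structures lifted from planar Poisson structures *)

Section PlanarLift.
Context {R : realType}.
Context (a b : R) (F : 'rV[R]_3 -> R).
Implicit Types x : 'rV[R]_3.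

(** The bivector [F d_0 /\ d_1 + d_2 /\ W] with [W = a x_0 d_0 + b x_1 d_1]. *)
Definition planar_lift (x : 'rV[R]_3) : 'M[R]_3 :=
  F x *: bivec (dvec 0) (dvec 1) + (a * x 0 0) *: bivec (dvec 2) (dvec 0)
  + (b * x 0 1) *: bivec (dvec 2) (dvec 1).

Definition Reeb (x : 'rV[R]_3) : 'rV[R]_3 := 2 *: dvec 2.

(** The last condition is [L_W (F d_0 /\ d_1) = 2 F d_0 /\ d_1], where the
    weights of [d_0] and [d_1] under [W] are [- a] and [- b]. *)
Definition homogeneous_density :=
  [/\ smooth_on setT F, forall x, 'D_(dvec 2) F x = 0 &
      forall x, a * x 0 0 * 'D_(dvec 0) F x + b * x 0 1 * 'D_(dvec 1) F x =
                (a + b + 2) * F x].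

Lemma planar_lift01 x : planar_lift x 0 1 = F x.
Proof. by rewrite /planar_lift /bivec !mxE !big_ord1 !mxE /=; ring. Qed.

Lemma planar_lift02 x : planar_lift x 0 2 = (- a) * x 0 0.
Proof. by rewrite /planar_lift /bivec !mxE !big_ord1 !mxE /=; ring. Qed.

Lemma planar_lift12 x : planar_lift x 1 2 = (- b) * x 0 1.
Proof. by rewrite /planar_lift /bivec !mxE !big_ord1 !mxE /=; ring. Qed.

Lemma smooth_planar_lift : smooth_on setT F -> smooth_on setT planar_lift.
Proof.
move=> Fs; do ?[apply: smoothD]; apply: smoothZl => //; apply: smoothM;
  by [exact: smooth_cst|exact: smooth_coord].
Qed.

Lemma derive_planar_lift (v x : 'rV[R]_3) :
  differentiable F x ->
  'D_v planar_lift x =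
    'D_v F x *: bivec (dvec 0) (dvec 1) + (a * v 0 0) *: bivec (dvec 2) (dvec 0)
    + (b * v 0 1) *: bivec (dvec 2) (dvec 1).
Proof.
move=> Fd; have cd c i : differentiable (fun y : 'rV[R]_3 => c * y 0 i) x.
  apply: smooth_diff; apply: smoothM.
    exact: smooth_cst.
  exact: smooth_coord.
rewrite /planar_lift deriveD ?deriveD ?derive_scalel ?derive_coordM //.
all: apply: diff_derivable; do ?[apply: differentiableD];
  exact: differentiableZl.
Qed.

(** In one half of [[P, P]], the terms that differentiate the coefficients of
    [W] give [- (a + b) F] and those that differentiate [F] give [W(F)], so the
    Euler equation is what makes it [E /\ P = 2 F d_0 /\ d_1 /\ d_2].  The
    coefficients do not depend on the last coordinate, so [[E, P]] vanishes. *)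
Lemma jacobi_planar_lift :
  homogeneous_density ->
  @jacobi_structure R 3 (euclidean R 3) (fun=> planar_lift) (fun=> Reeb).
Proof.
move=> [Fs F2 Feuler].
have e01 : (fun y => planar_lift y 0 1) = F.
  by apply/funext => y; exact: planar_lift01.
have e02 := funext planar_lift02; have e12 := funext planar_lift12.
have Pd x := smooth_diff x (smooth_planar_lift Fs).
split.
- apply: bivector_field_euclidean; first exact: smooth_planar_lift.
  have anti c u v : (c *: bivec u v)^T = - (c *: bivec u v) :> 'M[R]_3.
    by rewrite linearZ /= trmx_bivec scalerN.
  have antiD (A B : 'M[R]_3) : A^T = - A -> B^T = - B -> (A + B)^T = - (A + B).
    by move=> hA hB; rewrite linearD /= hA hB opprD.
  by move=> x; apply/antiD/anti; apply/antiD; exact: anti.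
- by apply: vector_field_euclidean; exact: smooth_cst.
move=> _ x _; split.
  rewrite [schouten _ _ _]schouten3 // wedge_d2_bivec [RHS]mulr2n volD.
  congr vol.
  rewrite e01 e02 e12 planar_lift01 planar_lift02 planar_lift12.
  rewrite !derive_coordM !mxE /=.
  have := Feuler x; lra.
apply: lie_bivec_cst => //; rewrite deriveZdir // derive_planar_lift ?F2;
  last exact: smooth_diff.
by rewrite !mxE /= !mulr0 !scale0r !addr0 scaler0.
Qed.

Lemma contact_planar_lift :
  homogeneous_density -> (forall x, F x != 0) ->
  @contact_structure R 3 (euclidean R 3) (fun=> planar_lift) (fun=> Reeb).
Proof.
move=> Fh Fn0; split; first exact: jacobi_planar_lift.
exists 1%N => // _ x _.
rewrite /wedge_pow /= wedge1r wedge_d2_bivec planar_lift01.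
move/ffunP/(_ finset.setT); rewrite !ffunE eqxx mulr1n => /eqP.
by rewrite mulf_eq0 pnatr_eq0 (negPf (Fn0 x)).
Qed.

End PlanarLift.

(** * The resolution *)

Section Resolution.
Context {R : realType}.
Implicit Types (x v : 'rV[R]_3).

(** The parameter [u = s ^ 3 * t] of the direction of the image point. *)
Definition slope x : R := x 0 0 ^+ 3 * x 0 1.

Definition res_x x : R := x 0 0 * (1 - slope x ^+ 4).

Definition res_y x : R := 2 * x 0 0 * slope x * (1 + slope x ^+ 2).

Definition resolution x : 'rV[R]_3 :=
  res_x x *: dvec 0 + res_y x *: dvec 1 + x 0 2 *: dvec 2.

(** The coefficient [G(u)] of the bivector upstairs: the quotient
    [(p ^ 4 + q ^ 4) / (p q' - q p')] for [p = 1 - u ^ 4] and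
    [q = 2 u (1 + u ^ 2)]. *)
Definition density x : R :=
  2^-1 * ((1 + slope x ^+ 2) * ((1 - slope x ^+ 2) ^+ 4 + 16 * slope x ^+ 4)).

Lemma smooth_slope : smooth_on setT slope.
Proof. by apply: smoothM; [apply: smoothX|]; exact: smooth_coord. Qed.

Lemma smooth_res_x : smooth_on setT res_x.
Proof.
apply: smoothM; first exact: smooth_coord.
apply: smoothD; first exact: smooth_cst.
by apply: smoothN; apply: smoothX; exact: smooth_slope.
Qed.

Lemma smooth_res_y : smooth_on setT res_y.
Proof.
apply: smoothM.
  apply: smoothM smooth_slope.
  by apply: smoothM; [exact: smooth_cst|exact: smooth_coord].
by apply: smoothD; [exact: smooth_cst|apply: smoothX; exact: smooth_slope].
Qed.

Lemma smooth_density : smooth_on setT density.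
Proof.
have uX n : smooth_on setT (fun x => slope x ^+ n).
  by apply: smoothX; exact: smooth_slope.
apply: smoothM; first exact: smooth_cst.
apply: smoothM; first by apply: smoothD => //; exact: smooth_cst.
apply: smoothD; last by apply: smoothM => //; exact: smooth_cst.
apply: smoothX; apply: smoothD; first exact: smooth_cst.
exact: smoothN.
Qed.

Lemma smooth_resolution : smooth_on setT resolution.
Proof.
apply: smoothD; last by apply: smoothZl; exact: smooth_coord.
by apply: smoothD; apply: smoothZl; [exact: smooth_res_x|exact: smooth_res_y].
Qed.

Lemma is_derive_slope x v :
  is_derive x v slope (3 * x 0 0 ^+ 2 * x 0 1 * v 0 0 + x 0 0 ^+ 3 * v 0 1).
Proof.
have coord i := is_derive_coord x v i.
apply: (is_derive_eq (is_derive_mul (is_derive_pow 2 (coord 0)) (coord 1))).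
by rewrite /=; ring.
Qed.

Lemma is_derive_res_x x v du : is_derive x v slope du ->
  is_derive x v res_x
    (v 0 0 * (1 - slope x ^+ 4) - 4 * x 0 0 * slope x ^+ 3 * du).
Proof.
move=> hu; have cst c := is_derive_const c x v.
apply: (is_derive_eq (is_derive_mul (is_derive_coord x v 0)
  (is_derive_add (cst 1) (is_derive_opp (is_derive_pow 3 hu))))).
by rewrite /=; ring.
Qed.

Lemma is_derive_res_y x v du : is_derive x v slope du ->
  is_derive x v res_y (2 * v 0 0 * slope x * (1 + slope x ^+ 2)
    + 2 * x 0 0 * (1 + 3 * slope x ^+ 2) * du).
Proof.
move=> hu; have cst c := is_derive_const c x v.
apply: (is_derive_eq (is_derive_mul
  (is_derive_mul (is_derive_mul (cst 2) (is_derive_coord x v 0)) hu)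
  (is_derive_add (cst 1) (is_derive_pow 1 hu)))).
by rewrite /=; ring.
Qed.

(** The density depends on the point through [slope] alone, so it is constant
    along every direction in which the slope is, in particular along
    [s d_s - 3 t d_t]. *)
Lemma is_derive_density x : exists c, forall v du,
  is_derive x v slope du -> is_derive x v density (c * du).
Proof.
exists (slope x * ((1 - slope x ^+ 2) ^+ 4 + 16 * slope x ^+ 4)
  + (1 + slope x ^+ 2)
    * (32 * slope x ^+ 3 - 4 * slope x * (1 - slope x ^+ 2) ^+ 3)).
move=> v du hu; have cst c := is_derive_const c x v.
apply: (is_derive_eq (is_derive_mul (cst 2^-1) (is_derive_mul
  (is_derive_add (cst 1) (is_derive_pow 1 hu))
  (is_derive_add
    (is_derive_pow 3
      (is_derive_add (cst 1) (is_derive_opp (is_derive_pow 1 hu))))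
    (is_derive_mul (cst 16) (is_derive_pow 3 hu)))))).
by rewrite /=; field.
Qed.

Lemma density_neq0 x : density x != 0.
Proof.
rewrite mulf_neq0 ?invr_eq0 ?pnatr_eq0 // mulf_neq0 //; apply: lt0r_neq0.
  by rewrite ltr_wpDr // exprn_even_ge0.
have [->|u0] := eqVneq (slope x) 0; first by rewrite !expr0n /=; lra.
by rewrite ltr_wpDl ?exprn_even_ge0 // mulr_gt0 // exprn_even_gt0.
Qed.

Lemma contact_resolution_source :
  @contact_structure R 3 (euclidean R 3)
    (fun=> planar_lift 1 (- 3) density) (fun=> @Reeb R).
Proof.
apply: contact_planar_lift density_neq0.
split=> [|x|x]; first exact: smooth_density.
  have [c hc] := is_derive_density x.
  rewrite (derive_val (is_derive := hc _ _ (is_derive_slope _ _))).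
  by rewrite !mxE /=; ring.
have [c hc] := is_derive_density x.
rewrite !(derive_val (is_derive := hc _ _ (is_derive_slope _ _))) !mxE /=.
by ring.
Qed.

Lemma derive_resolution x v : v *m 'J resolution x =
  'D_v res_x x *: dvec 0 + 'D_v res_y x *: dvec 1 + v 0 2 *: dvec 2.
Proof.
rewrite -deriveEjacobian; last exact: smooth_diff smooth_resolution.
have hx := smooth_diff x smooth_res_x; have hy := smooth_diff x smooth_res_y.
have hz := @differentiable_coord _ _ _ x 0 2.
rewrite /resolution deriveD ?deriveD ?derive_scalel ?derive_coord //.
all: by apply: diff_derivable; do ?[apply: differentiableD];
  exact: differentiableZl.
Qed.

Lemma Reeb_resolution x : Reeb x *m 'J resolution x = Reeb (resolution x).
Proof.
rewrite derive_resolution.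
rewrite (derive_val (is_derive := is_derive_res_x (is_derive_slope x _))).
rewrite (derive_val (is_derive := is_derive_res_y (is_derive_slope x _))).
by apply/rowP => j; rewrite !mxE /=; ring.
Qed.

Definition quartic x : R := x 0 0 ^+ 4 + x 0 1 ^+ 4.

Lemma resolution_00 x : resolution x 0 0 = res_x x.
Proof. by rewrite !mxE /=; ring. Qed.

Lemma resolution_01 x : resolution x 0 1 = res_y x.
Proof. by rewrite !mxE /=; ring. Qed.

Lemma resolution_02 x : resolution x 0 2 = x 0 2.
Proof. by rewrite !mxE /=; ring. Qed.

(** In the (s, t)-plane this is [G(u) * (p q' - q p')(u) = (p ^ 4 + q ^ 4)(u)]
    for the determinant, and [s d_s - 3 t d_t] is carried to the Euler field as
    it annihilates [u].  Once the partial derivatives of [u] are written out,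
    both are identities in which [u] is a free variable: [d_s u] cancels in the
    determinant, and [d_t u = s ^ 3] supplies the missing power of [s]. *)
Lemma pi_resolution x :
  ('J resolution x)^T *m planar_lift 1 (- 3) density x *m 'J resolution x =
  planar_lift 1 1 quartic (resolution x).
Proof.
rewrite /planar_lift !mulmxDr !mulmxDl -!scalemxAr -!scalemxAl !bivec_push.
have -> : dvec 2 *m 'J resolution x = dvec 2.
  apply: (@scalerI _ _ 2); first by rewrite pnatr_eq0.
  by rewrite scalemxAl Reeb_resolution.
rewrite !derive_resolution.
rewrite !(derive_val (is_derive := is_derive_res_x (is_derive_slope x _))).
rewrite !(derive_val (is_derive := is_derive_res_y (is_derive_slope x _))).
rewrite /quartic resolution_00 resolution_01 !mxE /= !scale0r !addr0.
rewrite bivec_frame.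
rewrite /res_x /res_y /density; move: (slope x) => u.
by congr (_ *: _ + _ *: _ + _ *: _); field.
Qed.

(** The condition [s = 0 -> u = 0] is what allows [t = u / s ^ 3].  Off the line
    [y = 0], the slope is the tangent of half of the polar angle. *)
Lemma resolution_surj (m : 'rV[R]_3) : exists x, resolution x = m.
Proof.
suff [s [u [su mx my]]] : exists s u, [/\ s = 0 -> u = 0,
    s * (1 - u ^+ 4) = m 0 0 & 2 * s * u * (1 + u ^+ 2) = m 0 1].
  pose x : 'rV[R]_3 := s *: dvec 0 + (u / s ^+ 3) *: dvec 1 + m 0 2 *: dvec 2.
  have x0 : x 0 0 = s by rewrite !mxE /=; ring.
  have x1 : x 0 1 = u / s ^+ 3 by rewrite !mxE /=; ring.
  have x2 : x 0 2 = m 0 2 by rewrite !mxE /=; ring.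
  have xu : slope x = u.
    rewrite /slope x0 x1; have [s0|s0] := eqVneq s 0; last by field.
    by rewrite (su s0) mul0r mulr0.
  exists x; apply/rowP => j.
  have [->|->|->] : [\/ j = 0, j = 1 | j = 2].
  - case: j => [[|[|[|//]]] h]; [apply: Or31|apply: Or32|apply: Or33];
      exact: val_inj.
  - by rewrite resolution_00 /res_x xu x0.
  - by rewrite resolution_01 /res_y xu x0.
  - by rewrite resolution_02.
move: (m 0 0) (m 0 1) => a b.
have [->|b0] := eqVneq b 0.
  by exists a, 0; split => //; ring.
pose r := Num.sqrt (a ^+ 2 + b ^+ 2).
have r2 : r ^+ 2 = a ^+ 2 + b ^+ 2 by rewrite sqr_sqrtr // addr_ge0 // sqr_ge0.
have ra : r - a != 0.
  apply: contra_neq b0 => /eqP; rewrite subr_eq0 => /eqP ra.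
  by apply/eqP; rewrite -sqrf_eq0; apply/eqP; move: r2; rewrite ra; lra.
pose u := (r - a) / b.
have u0 : u != 0 by rewrite mulf_neq0 // invr_eq0.
have u1 : 1 + u ^+ 2 != 0 by rewrite lt0r_neq0 // ltr_wpDr // sqr_ge0.
have ua : b * (1 - u ^+ 2) = 2 * u * a.
  apply/eqP; rewrite -subr_eq0; apply/eqP.
  transitivity ((a ^+ 2 + b ^+ 2 - r ^+ 2) / b); first by rewrite /u; field.
  by rewrite r2 subrr mul0r.
(* From here on, [u] is any root of [b * u ^ 2 + 2 * a * u - b]. *)
move: u u0 u1 ua => u u0 u1 ua.
exists (b / (2 * u * (1 + u ^+ 2))), u; split; last by field; rewrite u0 u1.
  move/eqP; rewrite mulf_eq0 invr_eq0 !mulf_eq0 pnatr_eq0.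
  by rewrite (negPf b0) (negPf u0) (negPf u1).
transitivity (b * (1 - u ^+ 2) / (2 * u)); first by field; rewrite u0 u1.
by rewrite ua; field.
Qed.

End Resolution.

Lemma example_piE (R : realType) :
  example_pi R = fun=> planar_lift 1 1 (@quartic R).
Proof.
apply/funext => i; apply/funext => p.
have flip n (u v : 'rV[R]_n) : bivec u v = - bivec v u by rewrite opprB.
by rewrite /example_pi /planar_lift !mul1r -scalerN -flip.
Qed.

Theorem proposition2p7 (R : realType) :
  jacobi_structure (example_pi R) (example_E R) /\
  admits_contact_resolution (example_pi R) (example_E R).
Proof.
have qs : smooth_on setT (@quartic R).
  by apply: smoothD; apply: smoothX; exact: smooth_coord.
rewrite example_piE; split.
  have qd x v : is_derive x v (@quartic R)
      (4 * x 0 0 ^+ 3 * v 0 0 + 4 * x 0 1 ^+ 3 * v 0 1).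
    by apply: is_derive_add; apply: is_derive_pow; exact: is_derive_coord.
  apply: jacobi_planar_lift; split=> // x.
    by rewrite (derive_val (is_derive := qd _ _)) !mxE /=; ring.
  by rewrite !(derive_val (is_derive := qd _ _)) !mxE /= /quartic; ring.
exists (euclidean R 3), (fun=> planar_lift 1 (- 3) (@density R)).
exists (fun=> @Reeb R), (@resolution R).
split; first exact: contact_resolution_source.
  apply: jacobi_morphism_euclidean; first exact: smooth_resolution.
    exact: Reeb_resolution.
  exact: pi_resolution.
exact: resolution_surj.
Qed.
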